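(* Let $G$ be a Cayley graph of a group $\Gamma$ and let $H$ be an infinite subgroup of $\Gamma$. Then for every $p\in[0,1]$ with $p>p_u(H;G)$ there is a unique $H$-infinite cluster in $G_p$ almost surely.
   Context: Cayley graphs are taken with respect to finite generating sets (so they are connected and locally finite, with vertex set $\Gamma$). $G_p$ denotes Bernoulli bond percolation on $G$: each edge is independently retained (open) with probability $p$ and deleted otherwise; connected components of $G_p$ are called clusters. For a set $A$ of vertices, a cluster $K$ is called $A$-infinite if $|K\cap A|=\infty$. The relative uniqueness threshold is $p_u(A;G)=\inf\{p\in[0,1]: \text{there exists a unique } A\text{-infinite cluster in } G_p \text{ almost surely}\}$. *)

(* Defs.v *)
From HB Require Import structures.
From mathcomp Require Import all_boot all_order all_algebra.
From mathcomp Require Import all_classical all_reals all_analysis.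
From mathcomp Require Import finmap measurable_realfun lra ring.

Set Implicit Arguments.
Unset Strict Implicit.
Unset Printing Implicit Defensive.
Import Order.TTheory GRing.Theory Num.Theory.
Local Open Scope classical_set_scope.
Local Open Scope ring_scope.

(* Edges are unordered pairs {x, xs}; left multiplication acts by graph
   automorphisms. The condition [s <> 1] excludes loops, which play no role in
   percolation. *)
Definition cayley_edges (G : groupType) (S : set G) : set (set G) :=
  [set e | exists x s, [/\ S s, s <> 1%g & e = [set x; (x * s)%g]]].

Definition is_subgroup (G : groupType) (H : set G) : Prop :=
  group_closed (mem H).

Definition generates (G : groupType) (S : set G) : Prop :=
  smallest (@is_subgroup G) S = setT.

Definition coordinate_events (E : Type) : set (set (E -> bool)) :=
  range (fun e : E => [set w : E -> bool | w e]).

Definition config (E : Type) := g_sigma_algebraType (@coordinate_events E).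

(* The product measure, through its values on finite cylinders: independent
   edges, each open ([true]) with probability [p]. *)
Definition bernoulli_law (R : realType) (E : choiceType) (p : R)
    (mu : probability (config E) R) : Prop :=
  forall (s : seq E) (b : E -> bool), uniq s ->
    mu [set w | forall e, e \in s -> w e = b e] =
    (\prod_(e <- s) (if b e then p else 1 - p))%:E.

Section clusters.
Variables (V : choiceType) (E : set (set V)).
Implicit Types (w : config E) (A K : set V) (x y : V).

Definition open_edge w x y : bool :=
  `[< exists e : E, val e = [set x; y] /\ w e >].

Definition cluster w x : set V :=
  [set y | exists2 s, path (open_edge w) x s & y = last x s].

Definition unique_infinite_cluster A w : Prop :=
  exists! K, range (cluster w) K /\ infinite_set (K `&` A).

Definition unique_infinite_cluster_as (R : realType) (p : R) A : Prop :=
  forall mu : probability (config E) R, bernoulli_law p mu ->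
    {ae mu, forall w, unique_infinite_cluster A w}.

(* For the Cayley graph of a finite generating set and infinite [A] this set
   contains 1, so the infimum never takes its default value. *)
Definition p_u (R : realType) A : R :=
  inf [set p | 0 <= p <= 1 /\ unique_infinite_cluster_as p A].
End clusters.

(* The laws quantified over above exist, so [unique_infinite_cluster_as] is not
   vacuous: read off the edge states from the digits of a uniform point of
   [0, 1) under the expanding map with branches x / p and (x - p) / (1 - p). *)
Section unit_lebesgue.
Variable R : realType.

Definition unit_itv := [set x : R | 0 <= x < 1].

Lemma unit_itvE : unit_itv = `[0, 1[%classic.
Proof. by apply/seteqP; split => x /=; rewrite in_itv. Qed.

Lemma measurable_unit_itv : measurable unit_itv.
Proof. by rewrite unit_itvE. Qed.

Let lam : {measure set _ -> \bar R} :=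
  mrestr (@lebesgue_measure R) measurable_unit_itv.

Definition unit_lebesgue : probability (measurableTypeR R) R :=
  mnormalize lam (@dirac _ (measurableTypeR R) (0 : R) R).

Lemma unit_lebesgueE A : unit_lebesgue A = lebesgue_measure (A `&` unit_itv).
Proof.
have lamT : lam setT = 1%E.
  rewrite /lam /= /mrestr setTI unit_itvE lebesgue_measure_itv /=.
  by rewrite lte_fin ltr01 sube0.
by rewrite /= /mnormalize lamT /= onee_eq0 /= invr1 mule1.
Qed.

End unit_lebesgue.

Section bernoulli_existence.
Variables (R : realType) (p : R).
Hypothesis p01 : 0 <= p <= 1.

Let step (x : R) : R := if x < p then x / p else (x - p) / (1 - p).

Let digit (n : nat) (x : R) : bool := iter n step x < p.

Let q (b : bool) : R := if b then p else 1 - p.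

Let measurable_step : measurable_fun setT step.
Proof.
apply: measurable_fun_ifT => /=.
- exact: measurable_fun_ltr.
- exact: measurable_funM.
- by apply: measurable_funM => //; exact: measurable_funB.
Qed.

Let measurable_digit n : measurable_fun setT (digit n).
Proof.
have H : measurable_fun setT (iter n step).
  elim: n => [|n IH] /=; first exact: measurable_id.
  exact: (measurableT_comp measurable_step IH).
exact: measurable_fun_ltr.
Qed.

Let prefix_event n (h : nat -> bool) :
  exists l, [/\ 0 <= l, l + \prod_(i < n) q (h i) <= 1 &
    [set x | 0 <= x < 1 /\ forall i, (i < n)%N -> digit i x = h i] =
    [set x | l <= x < l + \prod_(i < n) q (h i)]].
Proof.
have [p0 p1] := andP p01.
elim: n h => [|n IH] h.
  exists 0; rewrite big_ord0 add0r; split => //.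
  by apply/seteqP; split => x /= => [[]|].
have [l [l0 l1 lE]] := IH (fun i => h i.+1).
have w0 : 0 <= \prod_(i < n) q (h i.+1).
  by apply: prodr_ge0 => i _; rewrite /q; case: ifP; lra.
rewrite big_ord_recl /=.
under eq_bigr do rewrite /bump /= add1n.
set w := \prod_(i < n) _ in l1 lE w0 *.
have E x : (0 <= x < 1 /\ forall i, (i < n.+1)%N -> digit i x = h i) <->
    [/\ 0 <= x < 1, (x < p) = h 0%N &
        forall i, (i < n)%N -> digit i (step x) = h i.+1].
  split=> [[x01 H]|[x01 H0 HS]]; split => //; first exact: (H 0%N).
    by move=> i iin; rewrite -(H i.+1 iin) /digit iterSr.
  by case=> [|i] iin //; rewrite -HS // /digit iterSr.
have F x : 0 <= step x < 1 ->
    (forall i, (i < n)%N -> digit i (step x) = h i.+1) <->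
    l <= step x < l + w.
  move=> s01; have /seteqP[H1 H2] := lE; split => [H|H]; first exact: (H1 (step x)).
  by have [_ ?] := H2 (step x) H.
case h0: (h 0%N); rewrite /q.
- exists (p * l); split; [nra|nra|].
  apply/seteqP; split => x /=.
  + move=> /E[/andP[x0 x1]]; rewrite h0 => xp.
    have pp : 0 < p by lra.
    have sx : p * step x = x by rewrite /step xp; field; lra.
    move=> /F; nra.
  + move=> /andP[xl xr]; apply/E; rewrite h0.
    have pp : 0 < p by nra.
    have xp : x < p by nra.
    have sx : p * step x = x by rewrite /step xp; field; lra.
    split; [nra| by[] |apply/F; nra].
- exists (p + (1 - p) * l); split; [nra|nra|].
  apply/seteqP; split => x /=.
  + move=> /E[/andP[x0 x1]]; rewrite h0 => xp.
    have px : p <= x by rewrite leNgt xp.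
    have pp : 0 < 1 - p by lra.
    have sx : p + (1 - p) * step x = x by rewrite /step xp; field; lra.
    move=> /F; nra.
  + move=> /andP[xl xr]; apply/E; rewrite h0.
    have pp : 0 < 1 - p by nra.
    have px : p <= x by nra.
    have xp : (x < p) = false by rewrite ltNge px.
    have sx : p + (1 - p) * step x = x by rewrite /step xp; field; lra.
    split; [nra| by[] |apply/F; nra].
Qed.

Let event (t : seq nat) (h : nat -> bool) : set R :=
  [set x | 0 <= x < 1 /\ forall i, i \in t -> digit i x = h i].

Let measurable_event t h : measurable (event t h).
Proof.
rewrite /event (_ : [set _ | _] = `[0, 1[%classic `&`
    \bigcap_(i in [set` t]) (digit i @^-1` [set h i])); last first.
  rewrite -unit_itvE; apply/seteqP; split => x [x01 H]; split => // i it;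
    exact: H.
apply: measurableI => //; apply: bigcap_measurableType => i _.
by rewrite -[_ @^-1` _]setTI; exact: measurable_digit.
Qed.

Let event_lebesgue N t h : uniq t -> {subset t <= iota 0 N} ->
  lebesgue_measure (event t h) = (\prod_(i <- t) q (h i))%:E.
Proof.
have [k] := ubnP (N - size t); elim: k t h => // k IH t h kN ut tN.
have [p0 p1] := andP p01.
have q1 : q true + q false = 1 by rewrite /q addrC subrK.
have [tE|] := boolP (perm_eq t (iota 0 N)).
  have [l [l0 l1 lE]] := prefix_event N h.
  have -> : event t h = `[l, l + \prod_(i < N) q (h i)[%classic.
    transitivity [set x | l <= x < l + \prod_(i < N) q (h i)].
      rewrite -lE; apply/seteqP; split => x [x01 H]; split => // i it; apply: H.
        by rewrite (perm_mem tE) mem_iota.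
      by move: it; rewrite (perm_mem tE) mem_iota.
    by apply/seteqP; split => x /=; rewrite in_itv.
  rewrite lebesgue_measure_itv /= lte_fin (perm_big _ tE) /=.
  rewrite -[N in iota 0 N]subn0 -/(index_iota 0 N) big_mkord.
  case: ifPn => [_|]; rewrite -?leNgt.
    by rewrite -EFinD addrAC subrr add0r.
  have : 0 <= \prod_(i < N) q (h i).
    by apply: prodr_ge0 => i _; rewrite /q; case: ifP; lra.
  by move=> w0 lw; congr (_%:E); lra.
move=> ntE; have [j jN jt] : exists2 j, j \in iota 0 N & j \notin t.
  apply/hasP; apply: contraNT ntE => /hasPn H.
  apply: uniq_perm => //; first exact: iota_uniq.
  move=> i; apply/idP/idP => [/tN //|/H]; by rewrite negbK.
pose hj b i := if i == j then b else h i.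
have hjt b i : i \in t -> hj b i = h i.
  by rewrite /hj; case: eqP => // -> jt'; rewrite jt' in jt.
have ujt : uniq (j :: t) by rewrite /= jt.
have jtN : {subset j :: t <= iota 0 N}.
  by move=> i; rewrite inE => /predU1P[->//|/tN].
have szt : (size t < N)%N by have := uniq_leq_size ujt jtN; rewrite size_iota.
have ev b : lebesgue_measure (event (j :: t) (hj b)) =
    (q b * \prod_(i <- t) q (h i))%:E.
  rewrite IH //; last first.
    by rewrite /= subnS -ltnS prednK ?subn_gt0.
  rewrite big_cons {1}/hj eqxx; congr (_ * _)%:E.
  by apply: eq_big_seq => i it; rewrite hjt.
have -> : event t h = event (j :: t) (hj true) `|` event (j :: t) (hj false).
  apply/seteqP; split => x.
    move=> [x01 H]; case dj : (digit j x); [left|right]; split => // i;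
      by rewrite inE => /predU1P[->|it]; [rewrite /hj eqxx|rewrite hjt // H].
  by move=> [] [x01 H]; split => // i it; rewrite H ?inE ?it ?orbT // hjt.
transitivity (lebesgue_measure (event (j :: t) (hj true)) +
    lebesgue_measure (event (j :: t) (hj false)))%E.
  apply: measureU; [exact: measurable_event|exact: measurable_event|].
  apply/seteqP; split => x // [[_ H1] [_ H2]].
  by have := H1 j; rewrite H2 ?inE ?eqxx // /hj eqxx; move/(_ isT).
by rewrite !ev -EFinD -mulrDl q1 mul1r.
Qed.

Lemma bernoulli_law_exists (E : choiceType) : countable [set: E] ->
  exists mu : probability (config E) R, bernoulli_law p mu.
Proof.
move=> /countable_injP[f] finj.
have {}finj : injective f by move=> x y; apply: finj; exact: mem_set.
pose X (x : R) : config E := fun e => digit (f e) x.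
have mX : measurable_fun setT X.
  apply: (@measurability _ _ _ (config E) setT X (@coordinate_events E)) => //.
  move=> _ [_ [e _ <-] <-]; rewrite setTI.
  rewrite (_ : X @^-1` _ = digit (f e) @^-1` [set true]); last first.
    by apply/seteqP; split => x.
  by rewrite -[_ @^-1` _]setTI; exact: measurable_digit.
have mX' : measurable_fun [set: measurableTypeR R] X by exact: mX.
pose Xm : {mfun measurableTypeR R >-> config E} :=
  HB.pack X (isMeasurableFun.Build _ _ _ _ _ mX').
exists (distribution (unit_lebesgue R) Xm) => s b us.
pose h i := `[< exists2 e, f e = i & b e >].
have hf e : h (f e) = b e.
  by apply/asboolP/idP => [[e' /finj ->]//|be]; exists e.
have sN : {subset map f s <= iota 0 (\max_(e <- s) (f e)).+1}.
  move=> _ /mapP[e es ->]; rewrite mem_iota /= add0n ltnS.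
  exact: leq_bigmax_seq.
have := event_lebesgue h _ sN; rewrite map_inj_uniq // => /(_ us).
rewrite big_map; under eq_bigr do rewrite hf.
move=> <-; apply: etrans (unit_lebesgueE _) _.
congr lebesgue_measure; apply/seteqP; split => x.
  by move=> [H x01]; split => // _ /mapP[e es ->]; rewrite hf; exact: H.
by move=> [x01 H]; split => // e es /=; rewrite /X H ?hf //; exact: map_f.
Qed.
End bernoulli_existence.

Lemma countable_cayley_edges (G : groupType) (S : set G) :
  finite_set S -> generates S -> countable [set: cayley_edges S].
Proof.
move=> /finite_fsetP[X SX] Sgen.
pose word (w : seq (X * bool)) : G :=
  foldr (fun a g => ((if a.2 then val a.1 else (val a.1)^-1) * g)%g) 1%g w.
have word_cat w1 w2 : word (w1 ++ w2) = (word w1 * word w2)%g.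
  by elim: w1 => [|a w1 IH] /=; rewrite ?mul1g // IH mulgA.
have word_inv w : word (rev [seq (a.1, ~~ a.2) | a <- w]) = (word w)^-1%g.
  elim: w => [|a w IH]; first by rewrite invg1.
  rewrite /= rev_cons -cats1 word_cat IH invgM /= mulg1.
  by case: a.2; rewrite ?invgK.
have Gcnt : countable [set: G].
  have <- : range word = setT.
    apply/seteqP; split => // g _; move: (I : [set: G] g); rewrite -{1}Sgen.
    apply: smallest_sub; last first.
      move=> s; rewrite SX => sX; exists [:: ([` sX]%fset, true)] => //=.
      by rewrite mulg1.
    split; first by apply: mem_set; exists [::].
    move=> _ _ /set_mem[u _ <-] /set_mem[v _ <-]; apply: mem_set.
    by exists (u ++ rev [seq (a.1, ~~ a.2) | a <- v]);
      rewrite // word_cat word_inv.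
  exact: sub_countable (card_image_le _ _) (countableP _).
rewrite (eq_countable (card_setT _)).
have GGcnt := countableX Gcnt Gcnt.
apply: (@sub_countable _ _ _ _ _ GGcnt).
apply: card_le_trans (card_image_le (fun u => [set u.1; (u.1 * u.2)%g]) _).
apply: subset_card_le => _ [x [s [Ss s1 ->]]].
by exists (x, s).
Qed.

(* Main.v *)
Require Import Defs.
From HB Require Import structures.
From mathcomp Require Import all_boot all_order all_algebra.
From mathcomp Require Import all_classical all_reals all_analysis.

(** Why the theorem is true.  Let p1 < p be a parameter at which the H-infinite
    cluster is almost surely unique.  Couple the two percolations: the outer
    configuration has parameter p, and the inner one keeps each of its open
    edges with probability p1 / p, independently, hence has parameter p1.  It
    suffices that almost surely every H-infinite outer cluster contains a
    vertex whose inner cluster is H-infinite (a rich vertex): all rich vertices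
    lie in one inner cluster, hence in one outer cluster ([unique_outer]).

    Call an outer cluster poor when it is H-infinite and has no rich vertex.
    Poor clusters are excluded by a mass transport over the group H, which acts
    on the graph by left multiplication, preserves the law and acts freely and
    transitively on H.  Call an edge e = {x, y} a last bridge of z when it is
    open outside but closed inside, y is rich, and closing e in the outer
    configuration leaves z connected to x in a poor cluster.  A given z has at
    most one last bridge ([last_bridge_inj]), so the total mass sent by the
    vertex 1 to its last bridge is at most 1.  By translation the expected
    number of z in H whose last bridge is a fixed e is then at most 1 too,
    whereas an e that is the last bridge of one z is the last bridge of
    infinitely many z in H.  So almost surely there is no last bridge
    ([last_bridge_negligible], where Borel-Cantelli replaces expectations).

    Modifying the configuration on one edge preserves null events
    ([update_negligible]).  If x lies in a poor cluster and a neighbour y is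
    rich, opening the edge {x, y} in the outer configuration only makes it a
    last bridge; so this has probability zero.  If y is farther away, opening
    the final edge of a path from x to y in both configurations moves the rich
    vertex one step closer; by induction a poor cluster and a rich vertex almost
    surely do not coexist ([poor_rich_negligible]).  As there is a rich vertex
    almost surely, there is no poor cluster. *)

Import Defs Order.TTheory GRing.Theory Num.Theory.
Local Open Scope classical_set_scope.
Local Open Scope ring_scope.

Set Implicit Arguments.
Unset Strict Implicit.
Unset Printing Implicit Defensive.

(** * Product laws on configurations *)

Definition update (I : choiceType) (w : config I) (i : I) (b : bool) :
  config I := fun j => if j == i then b else w j.

Section configurations.
Variable I : choiceType.

Definition all_open (s : seq I) : set (config I) :=
  [set w | forall i, i \in s -> w i].

Lemma measurable_coordinate (i : I) : measurable [set w : config I | w i].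
Proof. by apply: sub_sigma_algebra; exists i. Qed.

Lemma measurable_to_config d (T : measurableType d) (f : T -> config I) :
  (forall i, measurable [set t | f t i]) -> measurable_fun setT f.
Proof.
move=> mf; apply: (@measurability _ _ _ (config I) setT f (@coordinate_events I)).
  by [].
by move=> _ [_ [i _ <-] <-]; rewrite setTI; exact: mf.
Qed.

Lemma all_open_cons i s : all_open (i :: s) = [set w : config I | w i] `&` all_open s.
Proof.
apply/seteqP; split => w.
  by move=> wis; split => [|j js]; apply: wis; rewrite inE ?eqxx // js orbT.
by move=> [wi ws] j; rewrite inE => /predU1P[->|/ws].
Qed.

Lemma measurable_all_open s : measurable (all_open s).
Proof.
elim: s => [|i s IH]; last first.
  by rewrite all_open_cons; apply: measurableI => //; exact: measurable_coordinate.
by rewrite (_ : all_open [::] = setT) //; apply/seteqP; split.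
Qed.

Lemma measurable_update i b : measurable_fun setT (fun w : config I => update w i b).
Proof.
apply: measurable_to_config => j; rewrite /update.
by case: eqP => _; [case: b; rewrite ?set_true ?set_false|exact: measurable_coordinate].
Qed.

End configurations.

Section product_laws.
Variable R : realType.

(** Only the cylinders on which finitely many edges are open are prescribed:
    they are stable under intersection and generate the sigma-algebra, so they
    determine a law. The probabilities [q] may vary with the coordinate because
    the coupling below mixes edge states of two different parameters. *)
Definition product_law (I : choiceType) (q : I -> R)
    (mu : set (config I) -> \bar R) : Prop :=
  forall s, uniq s -> mu (all_open s) = (\prod_(i <- s) q i)%:E.

Lemma bernoulli_product_law (I : choiceType) (p : R)
    (mu : probability (config I) R) :
  bernoulli_law p mu -> product_law (fun=> p) mu.
Proof.
move=> mup s us; rewrite -(mup s (fun=> true) us).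
by congr (mu _); apply/seteqP; split => w ws i /ws.
Qed.

Lemma all_open_determines (I : choiceType)
    (mu nu : {measure set (config I) -> \bar R}) :
  (mu setT < +oo)%E ->
  (forall s, uniq s -> mu (all_open s) = nu (all_open s)) ->
  forall A, measurable A -> mu A = nu A.
Proof.
move=> mufin munu A mA.
pose G := [set B : set (config I) | exists2 s, uniq s & B = all_open s].
apply: (@g_sigma_algebra_measure_unique _ _ _ G _ (fun=> setT)) => //.
- by move=> _ [s _ ->]; exact: measurable_all_open.
- by move=> _; exists [::] => //; apply/seteqP; split.
- by rewrite bigcup_const.
- move=> _ _ [s us ->] [t ut ->]; exists (undup (s ++ t)); first exact: undup_uniq.
  apply/seteqP; split => w.
    by move=> [ws wt] i; rewrite mem_undup mem_cat => /orP[/ws|/wt].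
  by move=> wst; split => i it; apply: wst; rewrite mem_undup mem_cat it ?orbT.
- by move=> _ [s us ->]; exact: munu.
- apply: smallest_sub mA; first exact: smallest_sigma_algebra.
  move=> _ [i _ <-]; apply: sub_sigma_algebra; exists [:: i] => //.
  apply/seteqP; split => w /= wi; first by move=> j; rewrite inE => /eqP ->.
  by apply: wi; rewrite inE.
Qed.

(** The image of a product law when each new coordinate is the conjunction of
    a block of old ones and distinct coordinates use disjoint blocks. This
    covers marginals, independent thinning and translations at once. *)
Lemma product_law_image (I J : choiceType) (q : I -> R) (q' : J -> R)
    (mu : probability (config I) R) (nu : probability (config J) R)
    (g : J -> seq I) :
  product_law q mu -> product_law q' nu ->
  (forall s, uniq s -> uniq (flatten (map g s))) ->
  (forall j, \prod_(i <- g j) q i = q' j) ->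
  forall A : set (config J), measurable A ->
    mu [set w : config I | A ((fun j => all w (g j)) : config J)] = nu A.
Proof.
move=> muq nuq ug qq' A mA.
pose f (w : config I) : config J := fun j => all w (g j).
have mf : measurable_fun setT f.
  apply: measurable_to_config => j.
  rewrite (_ : [set _ | _] = all_open (g j)); first exact: measurable_all_open.
  by apply/seteqP; split => w => [/allP|wg]; last exact/allP.
pose F : {mfun config I >-> config J} :=
  HB.pack f (isMeasurableFun.Build _ _ _ _ _ mf).
apply: (@all_open_determines _ (distribution mu F)) => //.
  exact: le_lt_trans (probability_le1 (distribution mu F) measurableT) (ltry _).
move=> s us; apply: etrans (esym (nuq s us)).
rewrite (_ : \prod_(j <- s) q' j = \prod_(i <- flatten (map g s)) q i); last first.
  by rewrite big_flatten big_map; apply: eq_bigr => j _; rewrite qq'.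
apply: etrans (muq _ (ug _ us)).
congr (mu _); apply/seteqP; split => w ws i.
  move=> /flattenP[_ /mapP[j js ->]] ig; exact: (allP (ws j js)).
move=> is_; apply/allP => k kg; apply: ws; apply/flattenP.
by exists (g i) => //; exact: map_f.
Qed.

(** Resampling one coordinate preserves a product law: the right-hand side is a
    measure that agrees with [mu] on the generating cylinders. *)
Lemma product_law_update (I : choiceType) (q : I -> R)
    (mu : probability (config I) R) (i : I) (A : set (config I)) :
  product_law q mu -> 0 <= q i <= 1 -> measurable A ->
  mu A = ((q i)%:E * mu [set w | A (update w i true)] +
    (1 - q i)%:E * mu [set w | A (update w i false)])%E.
Proof.
move=> muq /andP[q0 q1] mA; have q1' : 0 <= 1 - q i by rewrite subr_ge0.
pose U b : {mfun config I >-> config I} := HB.pack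
  (fun w : config I => update w i b)
  (isMeasurableFun.Build _ _ _ _ _ (measurable_update i b)).
pose mix := measure_add (mscale (NngNum q0) (distribution mu (U true)))
  (mscale (NngNum q1') (distribution mu (U false))).
transitivity (mix A); last by rewrite /mix measure_addE.
apply: (all_open_determines _ _ mA).
  exact: le_lt_trans (probability_le1 mu measurableT) (ltry _).
move=> s us; apply: etrans (esym (measure_addE _ _ _)).
rewrite /= /mscale /= /distribution /pushforward.
have [is_|is_] := boolP (i \in s); last first.
  have E b : U b @^-1` all_open s = all_open s.
    apply/seteqP; split => w ws j js; have := ws j js; rewrite /= /update;
      by case: eqP => // ji; rewrite -ji js in is_.
  by rewrite !E -ge0_muleDl ?lee_fin // -EFinD addrC subrK mul1e.
rewrite (_ : U true @^-1` _ = all_open (rem i s)); last first.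
  apply/seteqP; split => w ws j.
    rewrite mem_rem_uniq // inE => /andP[ji js]; have := ws j js.
    by rewrite /= /update (negbTE ji).
  rewrite /= /update; case: eqP => // /eqP ji js.
  by apply: ws; rewrite mem_rem_uniq // inE ji.
rewrite (_ : U false @^-1` _ = set0); last first.
  by apply/seteqP; split => w // /(_ _ is_); rewrite /= /update eqxx.
rewrite measure0 mule0 adde0 !muq ?rem_uniq // -EFinM.
by rewrite (perm_big _ (perm_to_rem is_)) big_cons.
Qed.

(** Insertion and deletion tolerance, in contrapositive form: an event of
    positive probability keeps positive probability after a coordinate has been
    forced to a value that it can take. *)
Lemma update_negligible (I : choiceType) (q : I -> R)
    (mu : probability (config I) R) (i : I) (b : bool) (N : set (config I)) :
  product_law q mu -> 0 <= q i <= 1 -> 0 < (if b then q i else 1 - q i) ->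
  mu.-negligible N -> mu.-negligible [set w | N (update w i b)].
Proof.
move=> muq q01 qb [A [mA A0 NA]].
exists [set w | A (update w i b)]; split.
- rewrite -[X in measurable X]setTI; exact: measurable_update.
- have [q0 q1] := andP q01.
  have := product_law_update muq q01 mA.
  rewrite A0 => /esym/eqP; rewrite padde_eq0 ?mule_ge0 ?lee_fin ?subr_ge0 //.
  by rewrite !mule_eq0 !eqe; move: qb; case: b => /gt_eqF -> /=; rewrite ?orFb;
    case/andP => /eqP ? /eqP.
- by move=> w /NA.
Qed.

(** The product measure, transported to configurations on the disjoint sum so
    that the pair is again a single product law. *)
Lemma product_law_couple (I J : choiceType) (q : I -> R) (r : J -> R)
    (mu : probability (config I) R) (nu : probability (config J) R) :
  product_law q mu -> product_law r nu ->
  exists P : probability (config (I + J)%type) R,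
    product_law (fun k => match k with inl i => q i | inr j => r j end) P.
Proof.
move=> muq nur.
pose f (t : config I * config J) : config (I + J)%type :=
  fun k => match k with inl i => t.1 i | inr j => t.2 j end.
have mf : measurable_fun setT f.
  apply: measurable_to_config => -[i|j].
  - rewrite -[X in measurable X]setTI.
    exact: (@measurable_fst _ _ (config I) (config J) measurableT _
      (measurable_coordinate i)).
  - rewrite -[X in measurable X]setTI.
    exact: (@measurable_snd _ _ (config I) (config J) measurableT _
      (measurable_coordinate j)).
pose F : {mfun (config I * config J)%type >-> config (I + J)%type} :=
  HB.pack f (isMeasurableFun.Build _ _ _ _ _ mf).
exists (distribution (mu \x nu)%E F) => s us.
pose getl (k : I + J) := if k is inl i then Some i else None.
pose getr (k : I + J) := if k is inr j then Some j else None.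
rewrite /distribution /pushforward /=.
transitivity ((mu \x nu)%E (all_open (pmap getl s) `*` all_open (pmap getr s))).
  congr (_ _); apply/seteqP; split => -[u v] /=.
    by move=> uvs; split => k /=; rewrite mem_pmap => /mapP[[i|j] ks //= [->]];
      exact: (uvs _ ks).
  by move=> [us_ vs] [i|j] ks /=; [apply: us_|apply: vs]; rewrite /= mem_pmap;
    apply/mapP; [exists (inl i)|exists (inr j)].
apply: etrans (product_measure1E _ _ (measurable_all_open _)
  (measurable_all_open _)) _.
have muE : mu (all_open (pmap getl s)) = (\prod_(i <- pmap getl s) q i)%:E.
  by apply: muq; apply: (@pmap_uniq _ _ _ (@inl I J)) us => -[].
have nuE : nu (all_open (pmap getr s)) = (\prod_(j <- pmap getr s) r j)%:E.
  by apply: nur; apply: (@pmap_uniq _ _ _ (@inr I J)) us => -[].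
apply: etrans (congr2 _ muE nuE) _.
rewrite -EFinM {muE nuE}; congr EFin; elim: s {us} => [|[i|j] s IH] /=.
- by rewrite !big_nil mulr1.
- by rewrite !big_cons -IH mulrA.
- by rewrite !big_cons -IH mulrCA.
Qed.

End product_laws.

(** * Countable index sets *)

Section countable_quantifiers.
Context d (T : measurableType d) (U : Type).
Hypothesis Ucnt : countable [set: U].

Lemma measurable_exists (P : U -> set T) : (forall u, measurable (P u)) ->
  measurable [set t | exists u, P u t].
Proof.
move=> mP; rewrite (_ : [set _ | _] = \bigcup_u P u).
  exact: countable_bigcupT_measurable.
by apply/seteqP; split => t [u]; exists u.
Qed.

Lemma measurable_forall (P : U -> set T) : (forall u, measurable (P u)) ->
  measurable [set t | forall u, P u t].
Proof.
move=> mP; rewrite (_ : [set _ | _] = ~` [set t | exists u, (~` P u) t]).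
  by apply: measurableC; apply: measurable_exists => u; exact: measurableC.
apply/seteqP; split => t /=; first by move=> + [u] => /(_ u).
by move=> /forallNP nP u; apply: contrapT => /nP.
Qed.

Lemma negligible_exists (R : realType) (mu : {measure set T -> \bar R})
    (P : U -> set T) : (forall u, mu.-negligible (P u)) ->
  mu.-negligible [set t | exists u, P u t].
Proof.
move=> nP; have /countable_injP[f finj] := Ucnt.
apply: (@negligibleS _ _ _ _ (\bigcup_n [set t | exists2 u, f u = n & P u t])).
  by move=> t [u Pu]; exists (f u) => //; exists u.
apply: negligible_bigcup => n.
have [[u fu]|none] := pselect (exists u, f u = n); last first.
  apply: negligibleS (negligible_set0 _) => t [u fu]; case: none; by exists u.
apply: negligibleS (nP u) => t [v fv]; suff -> : v = u by [].
by apply: finj; rewrite ?inE // fv fu.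
Qed.

End countable_quantifiers.

Lemma enumerate_infinite (V : Type) (A : set V) : countable A ->
  infinite_set A -> exists2 phi : nat -> V, injective phi & range phi = A.
Proof.
move=> cA /infiniteP iA.
have /card_set_bijP[f [_ finj fsurj]] : (A #= [set: nat])%card by apply/card_eqPle.
have /choice[phi phiP] n : exists x, A x /\ f x = n.
  by have [x Ax fx] := fsurj n I; exists x.
have phiK n : f (phi n) = n by have [] := phiP n.
exists phi; first exact: (can_inj phiK).
apply/seteqP; split => [_ [n _ <-]|x Ax]; first by have [] := phiP n.
by exists (f x) => //; apply: finj; rewrite ?inE ?phiK //; have [] := phiP (f x).
Qed.

(** This form of infiniteness only quantifies over integers, which makes it
    measurable and relates it to a limit superior of events. *)
Lemma infinite_setI_range (V : Type) (phi : nat -> V) (B : set V) :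
  injective phi ->
  infinite_set (B `&` range phi) <-> forall N, exists n, (N <= n)%N /\ B (phi n).
Proof.
move=> phi_inj; split=> [Binf N|Bfreq Bfin].
  apply: contrapT => none; apply: Binf.
  apply: (@sub_finite_set _ _ (phi @` `I_N)); last exact: finite_image.
  move=> x [Bx [n _ xE]]; rewrite -xE in Bx *; exists n => //=.
  by rewrite ltnNge; apply/negP => Nn; apply: none; exists n.
have : finite_set [set n | B (phi n)].
  rewrite (_ : [set _ | _] = phi @^-1` (B `&` range phi)).
    by apply: finite_preimage => // m n _ _ /phi_inj.
  by apply/seteqP; split => n /= => [Bn|[]//]; split => //; exists n.
move=> /finite_seqP[s sE]; have [n [sn Bn]] := Bfreq (\max_(i <- s) i).+1.
have : [set n | B (phi n)] n by [].
rewrite sE /= => ns; have : (n <= \max_(i <- s) i)%N by exact: leq_bigmax_seq.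
by rewrite leqNgt sn.
Qed.

(** At the two extreme parameters the configuration is deterministic. *)
Lemma ae_constant (R : realType) (I : choiceType) (p : R) (b : bool)
    (mu : probability (config I) R) : countable [set: I] -> bernoulli_law p mu ->
  (if b then p else 1 - p) = 0 -> {ae mu, forall w, forall i : I, w i = ~~ b}.
Proof.
move=> Icnt mup pb.
apply: (@negligibleS _ _ _ _ [set w : config I | exists i : I, w i = b]).
  by move=> w /existsNP[i wi]; exists i; case: b (w i) wi {pb} => [] [].
apply: (negligible_exists Icnt) => i.
have mi : measurable [set w : config I | w i = b].
  case: b {pb}; first exact: measurable_coordinate.
  rewrite (_ : [set _ | _] = ~` [set w : config I | w i]).
    by apply: measurableC; exact: measurable_coordinate.
  by apply/seteqP; split => w /= => [->|/negP/negbTE].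
apply/negligibleP => //.
have := mup [:: i] (fun=> b) isT; rewrite big_seq1 pb; apply: etrans.
congr (mu _); apply/seteqP; split => w /= wi.
  by move=> j; rewrite inE => /eqP ->.
by apply: wi; rewrite inE.
Qed.

(** * Clusters *)

Section cluster_theory.
Variables (V : choiceType) (E : set (set V)).
Implicit Types (v w : config E) (x y z : V) (e : E).

Lemma open_edgeP w x y :
  reflect (exists2 e : E, val e = [set x; y] & w e) (open_edge w x y).
Proof.
by apply: (iffP (asboolP _)) => [[e [ev we]]|[e ev we]]; exists e.
Qed.

Lemma open_edge_sym w x y : open_edge w x y = open_edge w y x.
Proof.
by apply/open_edgeP/open_edgeP => -[e ev we]; exists e; rewrite // setUC.
Qed.

Lemma cluster_refl w x : cluster w x x.
Proof. by exists [::]. Qed.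

Lemma cluster_step w x y z :
  cluster w x y -> open_edge w y z -> cluster w x z.
Proof.
move=> [s sp ->] yz; exists (rcons s z); last by rewrite last_rcons.
by rewrite rcons_path sp.
Qed.

Lemma cluster_ind w x (P : V -> Prop) : P x ->
  (forall y z, cluster w x y -> P y -> open_edge w y z -> P z) ->
  forall y, cluster w x y -> P y.
Proof.
move=> Px step y [s + ->]; elim/last_ind: s => [|s z IH] //=.
rewrite rcons_path last_rcons => /andP[sp lz].
by apply: step (IH sp) lz; exists s.
Qed.

Lemma cluster_trans w x y z : cluster w x y -> cluster w y z -> cluster w x z.
Proof.
by move=> xy; apply: cluster_ind => // a b _; exact: cluster_step.
Qed.

Lemma cluster_sym w x y : cluster w x y -> cluster w y x.
Proof.
move: y; apply: cluster_ind; first exact: cluster_refl.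
move=> y z _ yx yz; apply: cluster_trans yx.
by apply: (cluster_step (cluster_refl w z)); rewrite open_edge_sym.
Qed.

Lemma cluster_eq w x y : cluster w x y -> cluster w y = cluster w x.
Proof.
move=> xy; apply/seteqP; split => z; first exact: cluster_trans.
by apply: cluster_trans; exact: cluster_sym.
Qed.

(** It suffices to compare the two configurations on edges that start inside
    the smaller cluster: exploring a cluster never looks elsewhere. *)
Lemma sub_cluster v w x :
  (forall y z, cluster v x y -> open_edge v y z -> open_edge w y z) ->
  cluster v x `<=` cluster w x.
Proof.
move=> vw; apply: cluster_ind; first exact: cluster_refl.
by move=> y z xy xy' yz; apply: cluster_step xy' _; exact: vw yz.
Qed.

Lemma open_edge_mono v w x y :
  (forall e, v e -> w e) -> open_edge v x y -> open_edge w x y.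
Proof. by move=> vw /open_edgeP[e ev /vw we]; apply/open_edgeP; exists e. Qed.

Lemma cluster_mono v w x :
  (forall e, v e -> w e) -> cluster v x `<=` cluster w x.
Proof. by move=> vw; apply: sub_cluster => y z _; exact: open_edge_mono. Qed.

End cluster_theory.

Section coupled_configurations.
Variables (V : choiceType) (E : set (set V)) (H : set V).
Implicit Types (w : config (E + E)%type) (x y z : V) (e : E).

(** A configuration on [E + E] carries two independent states per edge. The
    second state thins the first one, which couples two percolations. *)
Definition outer w : config E := fun e => w (inl e).
Definition inner w : config E := fun e => w (inl e) && w (inr e).

Definition rich w y := infinite_set (cluster (inner w) y `&` H).

(** Richness is always that of [w], while the cluster is taken in a separate
    configuration [v], either [outer w] or [outer w] with one edge closed. *)
Definition poor w (v : config E) x :=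
  infinite_set (cluster v x `&` H) /\ forall y, cluster v x y -> ~ rich w y.

(** The edge [e] is oriented from the poor side, which contains [x] and [z], to
    the rich vertex [y]. Requiring [y] itself to be rich makes [e] the last
    such edge on the way from [z]; since [e] is closed in [inner w], closing it
    does not change which vertices are rich. *)
Definition last_bridge w e x y z :=
  [/\ val e = [set x; y], w (inl e) && ~~ w (inr e), rich w y,
      poor w (update (outer w) e false) x &
      cluster (update (outer w) e false) x z].

Lemma inner_outer w e : inner w e -> outer w e.
Proof. by rewrite /inner => /andP[]. Qed.

Lemma rich_cluster w x y : cluster (inner w) x y -> rich w y -> rich w x.
Proof. by move=> /cluster_eq xy; rewrite /rich xy. Qed.

(** The cluster of [z] cut off by one last bridge has no rich vertex, hence does
    not meet the rich end of the other bridge, so none of its edges is that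
    other bridge: each of the two cut-off clusters is contained in the other one. If
    the bridges were different edges, the first would still be open after the
    second is closed, and its rich end would lie in the common cluster. *)
Lemma last_bridge_inj w e e' x x' y y' z :
  last_bridge w e x y z -> last_bridge w e' x' y' z -> x = x'.
Proof.
have key e1 e2 x1 x2 y1 y2 : last_bridge w e1 x1 y1 z ->
    last_bridge w e2 x2 y2 z ->
    cluster (update (outer w) e1 false) z `<=`
    cluster (update (outer w) e2 false) z.
  move=> [ev1 _ _ [_ nr1] xz1] [ev2 _ ry2 _ _].
  apply: sub_cluster => a b za /[dup] ab /open_edgeP[f fv].
  rewrite {1}/update; case: eqP => // _ wf.
  apply/open_edgeP; exists f => //; rewrite /update; case: eqP => // fe2.
  have xa := cluster_trans xz1 za; have xb := cluster_step xa ab.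
  (* An edge inside the first cluster that were the second bridge would put
     the rich vertex y2 in that cluster. *)
  have : [set a; b] y2 by rewrite -fv fe2 ev2; right.
  by move=> [] y2E; [case: (nr1 a)|case: (nr1 b)]; rewrite // -y2E.
move=> b1 b2; have /seteqP KE :=
  conj (key _ _ _ _ _ _ b1 b2) (key _ _ _ _ _ _ b2 b1).
have [ev1 /andP[we1 _] ry1 [_ nr1] xz1] := b1.
have [ev2 _ ry2 [_ nr2] xz2] := b2.
have KE' : cluster (update (outer w) e false) x =
    cluster (update (outer w) e' false) x'.
  by rewrite -(cluster_eq xz1) -(cluster_eq xz2).
have xK : cluster (update (outer w) e' false) x' x.
  by rewrite -KE'; exact: cluster_refl.
have [ee'|/eqP ee'] := eqVneq e e'; last first.
  case: (nr2 y) => //; apply: cluster_step xK _; apply/open_edgeP.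
  by exists e => //; rewrite /update; case: eqP.
have : [set x'; y'] x by rewrite -ev2 -ee' ev1; left.
by case=> // xy'; case: (nr2 x) => //; rewrite xy'.
Qed.

Lemma poor_rich_disjoint w x y : poor w (outer w) x -> rich w y ->
  ~ cluster (outer w) x y.
Proof. by move=> [_ +] ry => /[apply]. Qed.

Definition set_edge w e a b := update (update w (inl e) a) (inr e) b.

Lemma outer_set_edge w e a b : outer (set_edge w e a b) = update (outer w) e a.
Proof. by apply/funext => f; rewrite /outer /set_edge /update. Qed.

Lemma inner_set_edge w e a b :
  inner (set_edge w e a b) = update (inner w) e (a && b).
Proof.
apply/funext => f; rewrite /inner /set_edge /update /=.
rewrite !(inj_eq inl_inj) !(inj_eq inr_inj).
by case: eqP.
Qed.

(** The edge was closed before, as a poor cluster has no rich vertex; opening it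
    in the outer configuration only changes nothing once it is cut again. *)
Lemma last_bridge_insert w e x y z : val e = [set x; y] ->
  poor w (outer w) x -> rich w y -> cluster (outer w) x z ->
  last_bridge (set_edge w e true false) e x y z.
Proof.
move=> ev px ry xz.
have we : outer w e = false.
  apply/negP => we; apply: (poor_rich_disjoint px ry).
  by apply: cluster_step (cluster_refl _ _) _; apply/open_edgeP; exists e.
have dE : update (outer (set_edge w e true false)) e false = outer w.
  rewrite outer_set_edge; apply/funext => f; rewrite /update.
  by case: eqP => [->|].
have sE : inner (set_edge w e true false) = inner w.
  rewrite inner_set_edge; apply/funext => f; rewrite /update.
  by case: eqP => [->|//]; apply/esym/negP => /inner_outer; rewrite we.
split => //; last by rewrite dE.
- by rewrite /set_edge /update /= !eqxx.
- by rewrite /rich sE.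
- by rewrite dE /poor /rich sE.
Qed.

(** The edge [e] does not touch the poor cluster of [x], which therefore stays
    the same together with all the inner clusters inside it. *)
Lemma poor_rich_approach w e x y y' : val e = [set y; y'] ->
  poor w (outer w) x -> rich w y' -> ~ cluster (outer w) x y ->
  let w' := set_edge w e true true in poor w' (outer w') x /\ rich w' y.
Proof.
move=> ev [Kinf nr] ry' xNy w'.
have xNy' : ~ cluster (outer w) x y' by move=> /nr.
have notin a b : cluster (outer w) x a -> val e <> [set a; b].
  move=> xa eab; have : [set y; y'] a by rewrite -ev eab; left.
  by case=> aE; rewrite aE in xa.
(* Opening [e] does not change a cluster that [e] does not touch. *)
have cutoff (u : config E) a : cluster (outer w) x a -> (forall f, u f -> outer w f) ->
    cluster (update u e true) a = cluster u a.
  move=> xa uw; apply/seteqP; split; last first.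
    by apply: cluster_mono => f; rewrite /update; case: eqP.
  apply: cluster_ind; first exact: cluster_refl.
  move=> b c _ ab /open_edgeP[f fv]; rewrite /update; case: eqP => [fe|_ uf].
    case: (notin b c); last by rewrite -fe fv.
    by apply: cluster_trans xa _; exact: (cluster_mono uw).
  by apply: cluster_step ab _; apply/open_edgeP; exists f.
have dE : outer w' = update (outer w) e true by exact: outer_set_edge.
have sE : inner w' = update (inner w) e true by exact: inner_set_edge.
split.
  rewrite /poor dE cutoff //; last exact: cluster_refl.
  split => // a xa; rewrite /rich sE cutoff //; first exact: nr.
  exact: inner_outer.
apply: (@rich_cluster w' y y').
  apply: cluster_step (cluster_refl _ _) _; apply/open_edgeP; exists e => //.
  by rewrite sE /update eqxx.
apply: sub_infinite_set ry' => b [y'b Hb]; split => //; rewrite sE.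
by move: y'b; apply: cluster_mono => f; rewrite /update; case: eqP.
Qed.

Lemma unique_outer w : unique_infinite_cluster H (inner w) ->
  (forall x, ~ poor w (outer w) x) -> unique_infinite_cluster H (outer w).
Proof.
move=> [_ [[[y _ <-] ry] yuniq]] nopoor.
have sub x : cluster (inner w) x `<=` cluster (outer w) x.
  by apply: cluster_mono; exact: inner_outer.
exists (cluster (outer w) y); split.
  split; first by exists y.
  by apply: sub_infinite_set ry => z [yz Hz]; split => //; exact: sub.
move=> _ [[x _ <-] xinf].
have [y' xy' ry'] : exists2 y', cluster (outer w) x y' & rich w y'.
  apply: contrapT => none; apply: (nopoor x); split => // y' xy' ry'.
  by apply: none; exists y'.
have yy' : cluster (inner w) y y'.
  by rewrite (yuniq (cluster (inner w) y')); [exact: cluster_refl|split=> //; exists y'].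
by rewrite -(cluster_eq xy') (cluster_eq (sub _ _ yy')).
Qed.

End coupled_configurations.

(** * Measurability of cluster events *)

Section measurable_clusters.
Context d (T : measurableType d) (V : choiceType) (E : set (set V)).
Hypothesis Vcnt : countable [set: V].
Variable f : T -> config E.
Hypothesis mf : forall e, measurable [set t | f t e].

Lemma measurable_open_edge x y : measurable [set t | open_edge (f t) x y].
Proof.
have [[e ev]|none] := pselect (exists e : E, val e = [set x; y]).
  rewrite (_ : [set _ | _] = [set t | f t e]); first exact: mf.
  apply/seteqP; split => t /=.
    by move=> /open_edgeP[e' e'v]; rewrite (val_inj (etrans e'v (esym ev))).
  by move=> fe; apply/open_edgeP; exists e.
rewrite (_ : [set _ | _] = set0); first exact: measurable0.
apply/seteqP; split => t //=.
by move=> /open_edgeP[e ev _]; apply: none; exists e.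
Qed.

Lemma measurable_cluster x y : measurable [set t | cluster (f t) x y].
Proof.
(* Paths are sorted by length in order to unfold them one step at a time. *)
pose reach n y := [set t |
  exists s, [/\ path (open_edge (f t)) x s, y = last x s & size s = n]].
rewrite (_ : [set _ | _] = [set t | exists n, reach n y t]); last first.
  apply/seteqP; split => t; first by move=> [s sp sy]; exists (size s), s.
  by move=> [n [s [sp sy _]]]; exists s.
apply: measurable_exists => // n; elim: n y => [|n IH] y.
  have [<-|xy] := eqVneq x y.
    rewrite (_ : reach _ _ = setT); first exact: measurableT.
    by apply/seteqP; split => // t _; exists [::].
  rewrite (_ : reach _ _ = set0); first exact: measurable0.
  apply/seteqP; split => // t [s [_ yx /size0nil s0]].
  by rewrite yx s0 eqxx in xy.
rewrite (_ : reach _ _ = [set t | exists z,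
    (reach n z `&` [set t | open_edge (f t) z y]) t]); last first.
  apply/seteqP; split => t.
    case; elim/last_ind => [[]//|s z _].
    rewrite rcons_path last_rcons size_rcons => -[/andP[sp lz] -> [sn]].
    by exists (last x s); split => //; exists s.
  move=> [z [[s [sp zs sn]] /= zy]]; exists (rcons s y).
  by rewrite rcons_path last_rcons size_rcons sn sp -zs.
apply: measurable_exists => // z; apply: measurableI => //.
exact: measurable_open_edge.
Qed.

Lemma measurable_infinite_cluster (A : set V) x :
  measurable [set t | infinite_set (cluster (f t) x `&` A)].
Proof.
have cA : countable A := sub_countable (subset_card_le (@subsetT _ A)) Vcnt.
have [Afin|] := pselect (finite_set A).
  rewrite (_ : [set _ | _] = set0); first exact: measurable0.
  apply/seteqP; split => t //; apply.
  by apply: sub_finite_set Afin => y [].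
move=> /(enumerate_infinite cA)[phi phi_inj phiA].
rewrite (_ : [set _ | _] = [set t | forall N, (fun N => [set t |
    exists n, [set t | (N <= n)%N /\ cluster (f t) x (phi n)] t]) N t]); last first.
  apply/seteqP; split => t /=.
    by rewrite -phiA => /(infinite_setI_range _ phi_inj).
  by rewrite -phiA => /(infinite_setI_range _ phi_inj).
apply: measurable_forall => // N; apply: measurable_exists => // n.
case: (leqP N n) => Nn; last first.
  rewrite (_ : [set _ | _] = set0); first exact: measurable0.
  by apply/seteqP; split => t //= -[].
rewrite (_ : [set _ | _] = [set t | cluster (f t) x (phi n)]).
  exact: measurable_cluster.
by apply/seteqP; split => t //= -[].
Qed.

Lemma measurable_unique_infinite_cluster (A : set V) :
  measurable [set t | unique_infinite_cluster A (f t)].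
Proof.
rewrite (_ : [set _ | _] = [set t | exists x,
    ([set t | infinite_set (cluster (f t) x `&` A)] `&`
    [set t | forall y, ([set t | cluster (f t) x y] `|`
      ~` [set t | infinite_set (cluster (f t) y `&` A)]) t]) t]); last first.
  apply/seteqP; split => t.
    move=> [_ [[[x _ <-] xinf] xuniq]]; exists x; split => // y.
    have [yinf|yfin] := pselect (infinite_set (cluster (f t) y `&` A)); last by right.
    left; rewrite /= (xuniq (cluster (f t) y)); first exact: cluster_refl.
    by split => //; exists y.
  move=> [x [xinf xuniq]]; exists (cluster (f t) x); split.
    by split => //; exists x.
  move=> _ [[y _ <-] yinf]; have [xy|//] := xuniq y.
  by rewrite (cluster_eq xy).
apply: measurable_exists => // x.
apply: measurableI; first exact: measurable_infinite_cluster.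
apply: measurable_forall => // y; apply: measurableU; first exact: measurable_cluster.
by apply: measurableC; exact: measurable_infinite_cluster.
Qed.

End measurable_clusters.

Section measurable_bridges.
Variables (V : choiceType) (E : set (set V)) (H : set V).
Hypothesis Vcnt : countable [set: V].

Lemma measurable_inner e : measurable [set w : config (E + E)%type | inner w e].
Proof.
rewrite (_ : [set _ | _] = [set w : config (E + E)%type | w (inl e)] `&`
    [set w : config (E + E)%type | w (inr e)]).
  by apply: measurableI; exact: measurable_coordinate.
by apply/seteqP; split => w /=; rewrite /inner => /andP.
Qed.

Lemma measurable_rich y :
  measurable [set w : config (E + E)%type | rich H w y].
Proof. by apply: measurable_infinite_cluster => // e; exact: measurable_inner. Qed.

Lemma measurable_last_bridge e x y z :
  measurable [set w : config (E + E)%type | last_bridge H w e x y z].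
Proof.
have mcut f : measurable [set w : config (E + E)%type |
    update (outer w) e false f].
  rewrite /update /outer; case: eqP => _; last exact: measurable_coordinate.
  rewrite (_ : [set _ | _] = set0); first exact: measurable0.
  by apply/seteqP; split.
rewrite (_ : [set _ | _] = [set w : config (E + E)%type | val e = [set x; y]] `&`
    ([set w : config (E + E)%type | w (inl e)] `&`
      ~` [set w : config (E + E)%type | w (inr e)]) `&`
    [set w | rich H w y] `&`
    [set w | infinite_set (cluster (update (outer w) e false) x `&` H)] `&`
    [set w | forall u, (~` [set w | cluster (update (outer w) e false) x u] `|`
      ~` [set w | rich H w u]) w] `&`
    [set w | cluster (update (outer w) e false) x z]); last first.
  apply/seteqP; split => w.
    move=> [ev /andP[we /negP we'] ry [xinf nr] xz].
    split => //; split; last first.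
      move=> u; have [xu|nxu] := pselect (cluster (update (outer w) e false) x u).
        by right; exact: nr.
      by left.
    by split => //; split => //; split.
  move=> [[[[[ev [we we']] ry] xinf] nr] xz]; split => //.
    by apply/andP; split => //; exact/negP.
  by split => // u xu ru; case: (nr u).
repeat apply: measurableI.
- have [ev|nev] := pselect (val e = [set x; y]).
    rewrite (_ : [set _ | _] = setT); first exact: measurableT.
    by apply/seteqP; split.
  rewrite (_ : [set _ | _] = set0); first exact: measurable0.
  by apply/seteqP; split.
- exact: measurable_coordinate.
- by apply: measurableC; exact: measurable_coordinate.
- exact: measurable_rich.
- exact: measurable_infinite_cluster.
- apply: measurable_forall => // u.
  apply: measurableU; apply: measurableC; last exact: measurable_rich.
  exact: measurable_cluster.
- exact: measurable_cluster.
Qed.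

End measurable_bridges.

(** * Left translation on a Cayley graph *)

Section left_translation.
Variables (G : groupType) (S : set G).
Let E := cayley_edges S.
Implicit Types (g h x y z : G) (v : config E) (w : config (E + E)%type) (e : E).

Lemma translate_edge_subproof g e : [set (g * x)%g | x in val e] \in E.
Proof.
have := set_valP e; move=> [x [s [Ss s1 ->]]]; apply: mem_set.
exists (g * x)%g, s; split => //.
by rewrite image_setU !image_set1 mulgA.
Qed.

Definition translate_edge g e : E := SigSub (translate_edge_subproof g e).

Lemma val_translate_edge g e x y : val e = [set x; y] ->
  val (translate_edge g e) = [set (g * x)%g; (g * y)%g].
Proof. by move=> /= ->; rewrite image_setU !image_set1. Qed.

Lemma translate_edgeK g : cancel (translate_edge g) (translate_edge g^-1%g).
Proof.
move=> e; apply: val_inj => /=; rewrite image_comp.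
rewrite (_ : _ \o _ = id) ?image_id //.
by apply/funext => x /=; rewrite mulKg.
Qed.

Definition translate g w : config (E + E)%type := fun k =>
  match k with
  | inl e => w (inl (translate_edge g e))
  | inr e => w (inr (translate_edge g e))
  end.

Definition translate1 g v : config E := fun e => v (translate_edge g e).

Lemma translate1K g : cancel (translate1 g) (translate1 g^-1%g).
Proof.
by move=> v; apply/funext => e; rewrite /translate1 -{1}[g]invgK translate_edgeK.
Qed.

Lemma cluster_translate1 g v x y :
  cluster (translate1 g v) x y <-> cluster v (g * x)%g (g * y)%g.
Proof.
have key h u a b : cluster (translate1 h u) a b -> cluster u (h * a)%g (h * b)%g.
  move: b; apply: cluster_ind; first exact: cluster_refl.
  move=> b c _ ab /open_edgeP[e ev ue]; apply: cluster_step ab _.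
  by apply/open_edgeP; exists (translate_edge h e) => //; exact: val_translate_edge.
split; first exact: key.
rewrite -{1}(translate1K g v) => /key; by rewrite !mulKg.
Qed.

Variable H : set G.
Hypothesis Hsub : is_subgroup H.

Lemma subgroup_mul x y : H x -> H y -> H (x * y)%g.
Proof.
have [H1 Hdiv] := Hsub; move=> /mem_set Hx /mem_set Hy; apply/set_mem.
have Hy' : (y^-1)%g \in H by rewrite -[(y^-1)%g]mul1g; exact: Hdiv.
by rewrite -[y]invgK; exact: Hdiv.
Qed.

Lemma subgroup_inv x : H x -> H x^-1%g.
Proof.
have [H1 Hdiv] := Hsub; move=> /mem_set Hx; apply/set_mem.
by rewrite -[(x^-1)%g]mul1g; exact: Hdiv.
Qed.

Lemma infinite_cluster_translate1 h v x : H h ->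
  infinite_set (cluster (translate1 h v) x `&` H) <->
  infinite_set (cluster v (h * x)%g `&` H).
Proof.
move=> Hh; have key g u a : H g -> infinite_set (cluster (translate1 g u) a `&` H) ->
    infinite_set (cluster u (g * a)%g `&` H).
  move=> Hg ainf afin; apply: ainf.
  apply: (@sub_finite_set _ _ ((fun b => g * b)%g @^-1` (cluster u (g * a)%g `&` H))).
    move=> b [/cluster_translate1 ab Hb]; split => //; exact: subgroup_mul.
  by apply: finite_preimage => // b c _ _; exact: mulgI.
split; first exact: key.
rewrite -{1}(translate1K h v) => /(key _ _ _ (subgroup_inv Hh)).
by rewrite mulKg.
Qed.

Lemma outer_translate h w : outer (translate h w) = translate1 h (outer w).
Proof. by []. Qed.

Lemma inner_translate h w : inner (translate h w) = translate1 h (inner w).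
Proof. by []. Qed.

Lemma rich_translate h w y : H h ->
  rich H (translate h w) y <-> rich H w (h * y)%g.
Proof. by move=> Hh; rewrite /rich inner_translate infinite_cluster_translate1. Qed.

Lemma last_bridge_translate h w e x y z : H h ->
  last_bridge H (translate h w) e x y z <->
  last_bridge H w (translate_edge h e) (h * x)%g (h * y)%g (h * z)%g.
Proof.
move=> Hh; have cutE : update (outer (translate h w)) e false =
    translate1 h (update (outer w) (translate_edge h e) false).
  apply/funext => f; rewrite outer_translate /translate1 /update.
  by rewrite (can_eq (translate_edgeK h)).
rewrite /last_bridge /poor cutE; split.
  move=> [ev we ry [xinf nr] xz]; split => //.
  - exact: val_translate_edge.
  - by apply/(rich_translate _ _ Hh).
  - split; first by apply/(infinite_cluster_translate1 _ _ Hh).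
    move=> u xu ru; apply: (nr (h^-1 * u)%g).
      by apply/cluster_translate1; rewrite mulVKg.
    by apply/(rich_translate _ _ Hh); rewrite mulVKg.
  - by apply/cluster_translate1.
move=> [ev we ry [xinf nr] xz]; split => //.
- have := val_translate_edge h^-1%g ev.
  by rewrite translate_edgeK !mulKg.
- by apply/(rich_translate _ _ Hh).
- split; first by apply/(infinite_cluster_translate1 _ _ Hh).
  by move=> u /cluster_translate1 xu /(rich_translate _ _ Hh); exact: nr.
- by apply/cluster_translate1.
Qed.

End left_translation.

Section cayley_graph.
Variables (G : groupType) (S : set G).
Hypothesis Sgen : generates S.
Let E := cayley_edges S.

Lemma cayley_connected (x y : G) : cluster ((fun=> true) : config E) x y.
Proof.
pose full : config E := fun=> true.
pose K := [set g | forall z, cluster full z (z * g)%g].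
have KT : K = setT.
  apply/seteqP; split => // g _; move: (I : [set: G] g); rewrite -Sgen.
  apply: smallest_sub; last first.
    move=> s Ss z; have [->|s1] := pselect (s = 1%g).
      by rewrite mulg1; exact: cluster_refl.
    apply: cluster_step (cluster_refl _ _) _; apply/open_edgeP.
    have eE : [set z; (z * s)%g] \in E by apply: mem_set; exists z, s.
    by exists (SigSub eE).
  split.
    by apply: mem_set => z; rewrite mulg1; exact: cluster_refl.
  move=> a b /set_mem Ka /set_mem Kb; apply: mem_set => z.
  apply: cluster_trans (Ka z) _; apply: cluster_sym.
  by have := Kb (z * (a * b^-1))%g; rewrite -!mulgA mulVg mulg1.
have : K (x^-1 * y)%g by rewrite KT.
by move=> /(_ x); rewrite mulVKg.
Qed.

Lemma infinite_generates (A : set G) : infinite_set A ->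
  exists2 s, S s & s <> 1%g.
Proof.
move=> Ainf; apply: contrapT => none; apply: Ainf.
apply: (@sub_finite_set _ _ [set 1%g]); last exact: finite_set1.
move=> g _; move: (I : [set: G] g); rewrite -Sgen; apply: smallest_sub.
  split; first exact: mem_set.
  by move=> _ _ /set_mem -> /set_mem ->; apply: mem_set; rewrite /= invg1 mulg1.
by move=> s Ss; apply: contrapT => s1; apply: none; exists s.
Qed.

Lemma countable_cayley_vertices (A : set G) : finite_set S -> infinite_set A ->
  countable [set: G].
Proof.
move=> Sfin /infinite_generates[s Ss s1].
have Ecnt : countable [set: E] := countable_cayley_edges Sfin Sgen.
have -> : [set: G] = \bigcup_(e in [set: E]) val e.
  apply/seteqP; split => // x _.
  have eE : [set x; (x * s)%g] \in E by apply: mem_set; exists x, s.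
  by exists (SigSub eE) => //; left.
apply: bigcup_countable => // e _; apply: finite_set_countable.
by have [x [t [_ _ ->]]] := set_valP e.
Qed.

End cayley_graph.

(** * Mass transport over the subgroup *)

Section marginals.
Variables (R : realType) (V : choiceType) (E : set (set V)).
Variables (p r : R) (P : probability (config (E + E)%type) R).
Hypothesis Pq :
  product_law (fun k : E + E => if k is inl _ then p else r) P.
Variables (mu : probability (config E) R) (A : set (config E)).
Hypothesis mA : measurable A.

Lemma outer_law : product_law (fun=> p) mu -> P [set w | A (outer w)] = mu A.
Proof.
move=> mup; rewrite -(product_law_image (g := fun e : E => [:: inl e]) Pq mup) //.
- congr (P _); apply/funext => w; congr (A _).
  by apply/funext => e; rewrite /= andbT.
- move=> s us; rewrite (_ : flatten _ = map inl s) ?map_inj_uniq //.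
    by move=> a b [].
  by elim: s {us} => //= a s ->.
- by move=> e; rewrite big_seq1.
Qed.

Lemma inner_law : product_law (fun=> p * r) mu -> P [set w | A (inner w)] = mu A.
Proof.
move=> mup.
rewrite -(product_law_image (g := fun e : E => [:: inl e; inr e]) Pq mup) //.
- congr (P _); apply/funext => w; congr (A _).
  by apply/funext => e; rewrite /= andbT.
- elim=> [|e s IH] //= /andP[es us]; rewrite IH // andbT.
  have notin k : k \in flatten [seq [:: inl e; inr e] | e <- s] ->
      k != inl e :> E + E /\ k != inr e :> E + E.
    move=> /flattenP[_ /mapP[f fs ->]]; rewrite !inE.
    have fe : f != e by apply: contraNneq es => <-.
    by case/orP => /eqP ->; split => //; apply/eqP => -[/eqP]; apply/negP.
  apply/andP; split; first by rewrite inE /=; apply/negP => /notin[]; rewrite eqxx.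
  by apply/negP => /notin[_]; rewrite eqxx.
- by move=> e; rewrite big_cons big_seq1.
Qed.

End marginals.

Section coupling.
Variables (R : realType) (G : groupType) (S : set G).
Let E := cayley_edges S.
Variables (H : set G).
Hypotheses (Sfin : finite_set S) (Sgen : generates S).
Hypotheses (Hsub : is_subgroup H) (Hinf : infinite_set H).
Variables (p r : R) (P : probability (config (E + E)%type) R).
Let q (k : (E + E)%type) : R := if k is inl _ then p else r.
Hypothesis Pq : product_law q P.

Let Gcnt : countable [set: G].
Proof. exact: countable_cayley_vertices Sgen _ Sfin Hinf. Qed.

Lemma measure_last_bridge_translate h e x y : H h ->
  P [set w | last_bridge H w e x y h] =
  P [set w | last_bridge H w (translate_edge h^-1%g e)
    (h^-1 * x)%g (h^-1 * y)%g 1%g].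
Proof.
move=> Hh; pose act (k : (E + E)%type) : (E + E)%type := match k with
  | inl e => inl (translate_edge h e) | inr e => inr (translate_edge h e) end.
have act_inj : injective act.
  have inj := can_inj (translate_edgeK h).
  by move=> [a|a] [b|b] //= ab; congr (_ _); apply: inj; apply: val_inj; case: ab.
have actE (w : config (E + E)%type) :
    translate h w = (fun k => all w [:: act k]) :> config (E + E)%type.
  by apply/funext => -[f|f]; rewrite /= andbT.
have e1 : translate_edge h (translate_edge h^-1%g e) = e.
  by rewrite -{1}[h]invgK translate_edgeK.
transitivity (P [set w | last_bridge H (translate h w) (translate_edge h^-1%g e)
    (h^-1 * x)%g (h^-1 * y)%g 1%g]).
  by congr (P _); apply/seteqP; split => w /=;
    rewrite last_bridge_translate // e1 !mulVKg mulg1.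
rewrite -[RHS](@product_law_image _ _ _ q q P P (fun k => [:: act k])) //.
- by congr (P _); apply/seteqP; split => w /=; rewrite actE.
- move=> s us; rewrite (_ : flatten _ = map act s) ?map_inj_uniq //.
  by elim: s {us} => //= a s ->.
- by move=> k; rewrite big_seq1; case: k.
- exact: measurable_last_bridge.
Qed.

(** Mass transport. The events that [e] is the last bridge of [h], for [h] in
    [H], have the same probabilities as the events that the translate of [e] by
    the inverse of [h] is the last bridge of 1. The latter are disjoint, so the
    probabilities are summable and Borel-Cantelli applies. *)
Lemma last_bridge_negligible e x y :
  P.-negligible [set w | infinite_set [set z | last_bridge H w e x y z /\ H z]].
Proof.
have cH : countable H := sub_countable (subset_card_le (@subsetT _ H)) Gcnt.
have [phi phi_inj phiH] := enumerate_infinite cH Hinf.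
have Hphi n : H (phi n) by rewrite -phiH; exists n.
pose F n := [set w | last_bridge H w e x y (phi n)].
have mF n : measurable (F n) by exact: measurable_last_bridge.
pose F' n := [set w | last_bridge H w (translate_edge (phi n)^-1%g e)
    ((phi n)^-1 * x)%g ((phi n)^-1 * y)%g 1%g].
have mF' n : measurable (F' n) by exact: measurable_last_bridge.
exists (lim_sup_set F); split.
- by apply: bigcapT_measurable => n; exact: bigcup_measurable.
- apply: lim_sup_set_cvg0 => //.
  rewrite (eq_eseriesr (fun n _ => measure_last_bridge_translate e x y (Hphi n))).
  rewrite -(measure_semi_bigcup P mF' _ (bigcupT_measurable _ mF')); last first.
    apply/trivIsetP => m n _ _ mn; apply/seteqP; split => w // [Fm Fn].
    have /mulIg/invg_inj/phi_inj mE := last_bridge_inj Fm Fn.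
    by rewrite mE eqxx in mn.
  apply: le_lt_trans (ltry 1); apply: probability_le1.
  exact: bigcupT_measurable.
- move=> w winf n _.
  have /(infinite_setI_range _ phi_inj)/(_ n)[k [nk Fk]] :
    infinite_set (last_bridge H w e x y `&` range phi) by rewrite phiH.
  by exists k.
Qed.

Hypotheses (p01 : 0 < p <= 1) (r01 : 0 < r < 1).

Lemma set_edge_negligible e b (N : set (config (E + E)%type)) :
  P.-negligible N -> P.-negligible [set w | N (set_edge w e true b)].
Proof.
have [p0 p1] := andP p01; have [r0 r1] := andP r01 => N0.
apply: (@update_negligible _ _ q P (inl e) true
  [set w | N (update w (inr e) b)]) => //=; first by rewrite ltW.
apply: (@update_negligible _ _ q P (inr e) b N) => //=; first by rewrite !ltW.
by case: b; rewrite // subr_gt0.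
Qed.

Lemma adjacent_poor_rich_negligible (e : E) x y : val e = [set x; y] ->
  P.-negligible [set w | poor H w (outer w) x /\ rich H w y].
Proof.
move=> ev.
apply: negligibleS (set_edge_negligible e false (last_bridge_negligible e x y)).
move=> w [px ry] /=; apply: sub_infinite_set px.1 => z [xz Hz]; split => //.
exact: last_bridge_insert.
Qed.

(** Induction on the distance between [x] and [y] in the Cayley graph. *)
Lemma poor_rich_negligible x y :
  P.-negligible [set w | poor H w (outer w) x /\ rich H w y].
Proof.
have := cayley_connected Sgen x y; move: y; apply: cluster_ind.
  apply: negligibleS (negligible_set0 _) => w [px rx].
  exact: (poor_rich_disjoint px rx (cluster_refl _ _)).
move=> y y' _ IH /open_edgeP[e ev _].
apply: negligibleS (negligibleU (adjacent_poor_rich_negligible ev)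
  (set_edge_negligible e true IH)) => w [px ry'].
(* Either [y] is already in the poor cluster and next to the rich [y'], or
   opening the edge between [y] and [y'] makes [y] rich. *)
have [xy|nxy] := pselect (cluster (outer w) x y); last first.
  by right; exact: (poor_rich_approach ev px ry' nxy).
by left; split => //; rewrite /poor (cluster_eq xy).
Qed.

Lemma ae_unique_outer :
  {ae P, forall w, unique_infinite_cluster H (inner w)} ->
  {ae P, forall w, unique_infinite_cluster H (outer w)}.
Proof.
move=> uin.
have npr : P.-negligible [set w | exists x,
    [set w | exists y, [set w | poor H w (outer w) x /\ rich H w y] w] w].
  do 2!apply: (negligible_exists Gcnt) => ?; exact: poor_rich_negligible.
apply: negligibleS (negligibleU uin npr) => w /= nuw.
have [uw|] := pselect (unique_infinite_cluster H (inner w)); last by left.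
right; apply: contrapT => none; apply: nuw; apply: unique_outer => // x px.
have [_ [[[y _ <-] ry] _]] := uw.
by apply: none; exists x, y.
Qed.

End coupling.

(** * Monotonicity of uniqueness *)

Section thresholds.
Variables (R : realType) (G : groupType) (S : set G) (H : set G).
Hypotheses (Sfin : finite_set S) (Sgen : generates S) (Hinf : infinite_set H).
Let E := cayley_edges S.

Let Ecnt : countable [set: E].
Proof. exact: countable_cayley_edges. Qed.

(** This makes the set that defines [p_u] nonempty, so that its infimum is
    approached by elements of the set. *)
Lemma unique_at_1 : unique_infinite_cluster_as E (1 : R) H.
Proof.
move=> mu mu1; apply: negligibleS (ae_constant (b := false) Ecnt mu1 (subrr _)).
move=> w /= nuw allw; apply: nuw.
have wT x : cluster w x = setT.
  apply/seteqP; split => // y _; have := cayley_connected Sgen x y.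
  by apply: cluster_mono => e _; rewrite allw.
exists setT; split; first by split; [exists 1%g|rewrite setTI].
by move=> _ [[x _ <-] _]; rewrite wT.
Qed.

(** Excludes the inner parameter 0, at which no edge could be inserted in the
    inner configuration. *)
Lemma unique_neq0 : ~ unique_infinite_cluster_as E (0 : R) H.
Proof.
have [|mu mu0] := @bernoulli_law_exists R 0 _ E Ecnt; first by rewrite lexx ler01.
move=> /(_ mu mu0) uw.
have cw := ae_constant (b := true) Ecnt mu0 erefl.
have : mu.-negligible setT.
  apply: negligibleS (negligibleU uw cw) => w _ /=.
  have [allw|] := pselect (forall e : E, w e = ~~ true); last by right.
  left => -[_ [[[x _ <-] xinf] _]]; apply: xinf.
  apply: (@sub_finite_set _ _ [set x]); last exact: finite_set1.
  move=> y [+ _]; move: y; apply: cluster_ind => // y z _ _ /open_edgeP[e _].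
  by rewrite allw.
move=> /(measure_negligible measurableT) mu0T.
have := @oner_neq0 R; rewrite -eqe => /eqP; apply.
exact: etrans (esym (probability_setT mu)) mu0T.
Qed.

End thresholds.

Theorem corollary1p5 (R : realType) (Gamma : groupType) (S : set Gamma)
    (Sfin : finite_set S) (Sgen : generates S)
    (H : set Gamma) (Hsub : is_subgroup H) (Hinf : infinite_set H)
    (p : R) (p01 : 0 <= p <= 1) (pu_p : p_u (cayley_edges S) R H < p) :
  unique_infinite_cluster_as (cayley_edges S) p H.
Proof.
have Gcnt : countable [set: Gamma].
  exact: countable_cayley_vertices Sgen _ Sfin Hinf.
have Ecnt : countable [set: cayley_edges S] by exact: countable_cayley_edges.
have [p1 [/andP[p1_ge0 p1_le1] uniq1] p1p] : exists2 p1 : R,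
    0 <= p1 <= 1 /\ unique_infinite_cluster_as (cayley_edges S) p1 H & p1 < p.
  apply: inf_lt pu_p; exists 1; split; first by rewrite ler01 lexx.
  exact: unique_at_1.
have p1_gt0 : 0 < p1.
  rewrite lt_def p1_ge0 andbT; apply: contra_notN (@unique_neq0 R _ S H Sfin Sgen).
  by move/eqP <-.
have p_gt0 : 0 < p by exact: lt_trans p1p.
have r01 : 0 < p1 / p < 1 by rewrite divr_gt0 // ltr_pdivrMr // mul1r.
move=> mu mup.
have [|nu nur] := @bernoulli_law_exists R (p1 / p) _ _ Ecnt.
  by case/andP: r01 => /ltW -> /ltW ->.
have [|nu1 nu1p1] := @bernoulli_law_exists R p1 _ _ Ecnt; first by rewrite p1_ge0.
have [P Pq] :=
  product_law_couple (bernoulli_product_law mup) (bernoulli_product_law nur).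
have uinner : {ae P, forall w, unique_infinite_cluster H (inner w)}.
  have [N [mN N0 uN]] := uniq1 nu1 nu1p1.
  exists [set w | N (inner w)]; split.
  - have minner : measurable_fun setT (@inner _ (cayley_edges S)).
      by apply: measurable_to_config => e; exact: measurable_inner.
    by rewrite -[X in measurable X]setTI; exact: minner.
  - have law1 : product_law (fun=> p * (p1 / p)) nu1.
      by rewrite mulrC divfK ?gt_eqF //; exact: bernoulli_product_law.
    exact: etrans (inner_law Pq mN law1) N0.
  - by move=> w; exact: uN.
have uouter : {ae P, forall w, unique_infinite_cluster H (outer w)}.
  apply: (ae_unique_outer Sfin Sgen Hsub Hinf Pq) => //.
  by rewrite p_gt0; case/andP: p01.
have mU := measurable_unique_infinite_cluster Gcnt
  (f := @id (config (cayley_edges S))) (@measurable_coordinate _) H.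
have mU' := measurableC mU.
exists (~` [set w | unique_infinite_cluster H w]); split => //.
apply: etrans (esym (outer_law Pq mU' (bernoulli_product_law mup))) _.
apply: measure_negligible; last exact: uouter.
have mouter : measurable_fun setT (@outer _ (cayley_edges S)).
  by apply: measurable_to_config => e; exact: measurable_coordinate.
by rewrite -[X in measurable X]setTI; exact: mouter.
Qed.
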